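(* Suppose $N>M>2$ and let the weight vector $\vec w=(w_1,\dots,w_N)$ (positive entries summing to $1$) satisfy $$w_i\in\left[\frac{M-1}{M(N-1)},\ \frac{N-2M+M^2}{M^2(N-1)}\right]\quad\text{for all } i\in[N].$$ Then the sortition algorithm Cumulative Rejection Sampling is $\lambda$-decentralized with $\lambda=M\min_{i\in[N]}w_i$.
   Context: Setting: there are $N$ participants, indexed by $[N]=\{1,\dots,N\}$, with positive weights $w_i$, $\sum_i w_i=1$. A sortition algorithm outputs a random committee $\mathcal{M}\subseteq[N]$ of size $M$ and unnormalized weights $g_n$; the voting power is $g(n;\mathcal{M})=g_n/\sum_{m\in\mathcal{M}}g_m$ for $n\in\mathcal{M}$ and $g(n;\mathcal{M})=0$ for $n\notin\mathcal{M}$. For $\lambda>0$, the algorithm is $\lambda$-decentralized if for every committee realization $\mathcal{M}$ (every committee that can be output), $\max_{m\in\mathcal{M}}\frac{g(m;\mathcal{M})}{w_m}\le\frac1\lambda$. Algorithm Cumulative Rejection Sampling (input $\vec w$, $M$): (1) compute $p_i=\frac{M(N-1)}{N-M}w_i-\frac{M-1}{N-M}$ for $i\in[N]$; (2) generate a uniformly random $M$-element subset $\mathcal{M}=\{m_1,\dots,m_M\}$ of $[N]$; (3) generate an independent $U$ uniform on $[0,1]$; if $U\ge\sum_{j=1}^M p_{m_j}$, reject $\mathcal{M}$ and return to step (2) with fresh independent randomness; (4) otherwise output $\mathcal{M}$ with $g_m=1$ for $m\in\mathcal{M}$ and $g_m=0$ for $m\notin\mathcal{M}$. *)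

(* Defs.v *)
From HB Require Import structures.
From mathcomp Require Import all_boot all_order all_algebra finmap.
From mathcomp Require Import all_classical all_reals all_analysis.

Set Implicit Arguments.
Unset Strict Implicit.
Unset Printing Implicit Defensive.

Import Order.TTheory GRing.Theory Num.Theory.
Import numFieldNormedType.Exports.

Local Open Scope classical_set_scope.
Local Open Scope ring_scope.

(* Participants are the elements of 'I_N.  A sortition scheme on the sample    *)
(* space T draws a committee (None when the procedure never outputs anything)  *)
(* and attaches to each committee C the unnormalized weights g_n.              *)
Record sortition_scheme (R : realType) (T : Type) (N : nat) := SortitionScheme {
  committee : T -> option {set 'I_N};
  gweight : {set 'I_N} -> 'I_N -> R }.

Section Sortition.
Context d (T : measurableType d) (R : realType) (P : probability T R) (N : nat).
Implicit Types (A : sortition_scheme R T N) (C : {set 'I_N}) (n : 'I_N).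

Definition output_event A C : set T := [set t | committee A t = Some C].

Definition sortition_algorithm (M : nat) A : Prop :=
  (forall C, measurable (output_event A C)) /\
  P [set t | exists2 C : {set 'I_N}, committee A t = Some C & #|C| = M] = 1%E.

Definition voting_power A n C : R :=
  if n \in C then gweight A C n / \sum_(m in C) gweight A C m else 0.

(* The committees that can be output are those of positive probability.  As    *)
(* lambda > 0, starting the maximum from 0 does not affect the comparison with *)
(* lambda^-1, whatever the sign of the voting powers.                          *)
Definition decentralized (w : 'I_N -> R) A (lambda : R) : Prop :=
  0 < lambda /\
  forall C, (0 < P (output_event A C))%E ->
    \big[Num.max/0]_(m in C) (voting_power A m C / w m) <= lambda^-1.

End Sortition.

(* Mutual independence of the classes of events F i. *)
Definition mutually_independent d (T : measurableType d) (R : realType)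
    (P : probability T R) (I : choiceType) (F : I -> set (set T)) : Prop :=
  (forall i, F i `<=` measurable) /\
  forall (J : {fset I}) (E : I -> set T), (forall i, i \in J -> F i (E i)) ->
    P (\bigcap_(i in [set` J]) E i) = (\prod_(i <- J) P (E i))%E.

Section CumulativeRejectionSampling.
Context d (T : measurableType d) (R : realType) (P : probability T R).
Variables (N M : nat) (w : 'I_N -> R).
(* S k and U k are the candidate committee and the uniform variable drawn in   *)
(* the k-th round; the draws of the rounds following acceptance are unused.    *)
Variables (S : nat -> T -> {set 'I_N}) (U : nat -> {RV P >-> R}).

Definition draw_events (i : nat + nat) : set (set T) :=
  match i with
  | inl k => [set S k @^-1` B | B in [set: set {set 'I_N}]]
  | inr k => [set U k @^-1` B | B in measurable]
  end.

Definition crs_randomness : Prop :=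
  [/\ forall k C,
        P (S k @^-1` [set C]) = (if #|C| == M then ('C(N, M)%:R)^-1 else 0)%:E,
      forall k (B : set R), measurable B ->
        distribution P (U k) B = uniform_prob (@ltr01 R) B
    & mutually_independent P draw_events].

Definition crs_p (i : 'I_N) : R :=
  M%:R * (N%:R - 1) / (N%:R - M%:R) * w i - (M%:R - 1) / (N%:R - M%:R).

Definition crs_accept (t : T) (k : nat) : bool :=
  ~~ (\sum_(j in S k t) crs_p j <= U k t).

Definition crs_committee (t : T) : option {set 'I_N} :=
  match pselect (exists k, crs_accept t k) with
  | left ex => Some (S (ex_minn ex) t)
  | right _ => None
  end.

Definition crs : sortition_scheme R T N :=
  SortitionScheme crs_committee (fun C n => if n \in C then 1 else 0).

End CumulativeRejectionSampling.

(* Main.v *)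
(** The bounds on [w] amount to [0 <= p_i <= 1/M], and the [p_i] sum to 1, so the
    acceptance threshold of an [M]-subset lies in [[0,1]] and is positive for at
    least one subset.  A round therefore rejects with a probability [< 1] that
    is the same for all rounds, and by independence the sampling almost surely
    stops, with a committee of size [M].  All the members of such a committee
    have voting power [1/M], so the ratios [g(m)/w_m] are at most
    [1/(M min w)]. *)
Require Import Defs.
From HB Require Import structures.
From mathcomp Require Import all_boot all_order all_algebra finmap.
From mathcomp Require Import all_classical all_reals all_analysis.
From mathcomp Require Import ring lra.

Set Implicit Arguments.
Unset Strict Implicit.
Unset Printing Implicit Defensive.

Import Order.TTheory GRing.Theory Num.Theory.
Import numFieldNormedType.Exports.

Local Open Scope classical_set_scope.
Local Open Scope ring_scope.

(** * Finite union bound and tails of the uniform law *)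

Lemma measure_bigsetU_le d (T : measurableType d) (R : realType)
    (mu : measure T R) (I : Type) (r : seq I) (F : I -> set T) :
  (forall i, measurable (F i)) ->
  (mu (\big[setU/set0]_(i <- r) F i) <= \sum_(i <- r) mu (F i))%E.
Proof.
move=> mF; elim: r => [|i r IHr]; first by rewrite !big_nil measure0.
rewrite !big_cons (le_trans (measureU2 _ _ _)) ?leeD2l//.
exact: bigsetU_measurable.
Qed.

(** The ray meets the support [[0, 1]] in [[s, 1]], where the density is 1. This gives the chance of
    rejecting a candidate of threshold [s]. *)
Lemma uniform_prob_ge (R : realType) (s : R) : 0 <= s <= 1 ->
  uniform_prob (@ltr01 R) [set x | s <= x] = (1 - s)%:E.
Proof.
move=> /andP[s0 s1].
rewrite /uniform_prob integral_uniform_pdf.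
have -> : [set x | s <= x] `&` `[0, 1] = `[s, 1]%classic :> set R.
  apply/seteqP; split => x /=; rewrite !in_itv/=; last by lra.
  by move=> [-> /andP[_ ->]].
rewrite (eq_integral (cst 1%E)); last first.
  move=> x; rewrite inE/= in_itv/= => /andP[sx x1].
  by rewrite /uniform_pdf (le_trans s0 sx) x1 subr0 invr1.
rewrite integral_cst//= mul1e lebesgue_measure_itv/= lte_fin.
by case: ltgtP s1 => // -> _; rewrite subrr.
Qed.

(** * Arithmetic of the numbers [crs_p] and subsets of given size *)

Lemma crs_p_bounds (R : realType) (N M : nat) (w : 'I_N -> R) (i : 'I_N) :
  (2 < M)%N -> (M < N)%N ->
  (M%:R - 1) / (M%:R * (N%:R - 1)) <= w i
        <= (N%:R - 2 * M%:R + M%:R ^+ 2) / (M%:R ^+ 2 * (N%:R - 1)) ->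
  0 <= crs_p M w i <= M%:R^-1.
Proof.
rewrite -(ltr_nat R) -(ltr_nat R M) => hM hMN.
have M0 : 0 < M%:R :> R by lra.
have N1 : 0 < N%:R - 1 :> R by lra.
have NM : 0 < N%:R - M%:R :> R by lra.
rewrite ler_pdivrMr ?mulr_gt0// ler_pdivlMr ?mulr_gt0 ?exprn_gt0// => /andP[l u].
(* Over the common denominator [N - M] the numerator is [M (N - 1) w i - (M - 1)]; the ends of the
   interval for [w i] are the points where the quotient equals 0 and [1/M]. *)
rewrite /crs_p mulrAC -mulrBl.
rewrite divr_ge0 ?(ltW NM)//=; last by lra.
rewrite ler_pdivrMr// -(ler_pM2l M0) mulrA divff ?gt_eqF// mul1r.
lra.
Qed.

Lemma crs_p_sum (R : realType) (N M : nat) (w : 'I_N -> R) :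
  (M < N)%N -> \sum_(i < N) w i = 1 -> \sum_(i < N) crs_p M w i = 1.
Proof.
rewrite -(ltr_nat R) => hMN w1.
rewrite big_split/= -mulr_sumr w1 sumr_const card_ord -mulr_natl.
by field; rewrite subr_eq0 gt_eqF.
Qed.

Lemma crs_p_committee (R : realType) (N M : nat) (w : 'I_N -> R)
    (C : {set 'I_N}) : (0 < M)%N ->
  (forall i, 0 <= crs_p M w i <= M%:R^-1) -> #|C| = M ->
  0 <= \sum_(j in C) crs_p M w j <= 1.
Proof.
move=> M0 p CM; apply/andP; split.
  by apply: sumr_ge0 => i _; case/andP: (p i).
have -> : 1 = \sum_(j in C) M%:R^-1 :> R.
  by rewrite sumr_const CM -[RHS]mulr_natl divff// pnatr_eq0 -lt0n.
by apply: ler_sum => i _; case/andP: (p i).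
Qed.

(** The singleton of [i] is enlarged one element at a time. This provides a candidate containing a
    participant with positive [crs_p]. *)
Lemma ex_subset_card (I : finType) (i : I) (m : nat) :
  (0 < m <= #|I|)%N -> exists2 C : {set I}, #|C| = m & i \in C.
Proof.
elim: m => // -[_ _|m IHm /andP[_ mI]].
  by exists [set i]%SET; rewrite ?cards1 ?inE.
have [|C Cm iC] := IHm; first exact: ltnW.
have /finset.set0Pn[j] : (~: C != finset.set0)%SET by rewrite -card_gt0 cardsCs finset.setCK Cm subn_gt0.
rewrite inE => jC; exists (j |: C)%SET; last by rewrite !inE iC orbT.
by rewrite cardsU1 jC Cm.
Qed.

Lemma measurable_ge (R : realType) (a : R) : measurable [set x : R | a <= x].
Proof.
have -> : [set x | a <= x] = `[a, +oo[%classic.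
  by apply/seteqP; split=> x /=; rewrite in_itv/= andbT.
exact: measurable_itv.
Qed.

(** * Measurability of the events of a round and of the output *)

Section CrsLaw.
Context (R : realType) (d : measure_display) (T : measurableType d).
Context (P : probability T R) (N M : nat) (w : 'I_N -> R).
Context (S : nat -> T -> {set 'I_N}) (U : nat -> {RV P >-> R}).
Hypothesis rand : crs_randomness M S U.

Let s (C : {set 'I_N}) : R := \sum_(j in C) crs_p M w j.

Lemma crs_voting_power (C : {set 'I_N}) (n : 'I_N) : n \in C ->
  voting_power (crs M w S U) n C = #|C|%:R^-1.
Proof.
move=> nC; rewrite /voting_power/= nC.
rewrite (eq_bigr (fun=> 1)) => [|i ->//].
by rewrite sumr_const mul1r.
Qed.

(** Measurability of the candidates comes from [mutually_independent], which requires its classes to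
    consist of measurable events. *)
Lemma measurable_candidate k (C : {set 'I_N}) :
  measurable (S k @^-1` [set C]).
Proof.
have [_ _ [mF _]] := rand.
by apply: (mF (inl k)); exists [set C].
Qed.

Lemma measurable_threshold k (a : R) : measurable [set t | a <= U k t].
Proof.
exact: (measurable_funPTI (U k) (measurable_ge a)).
Qed.

(** The threshold depends on the random candidate, but it is constant on each of the finitely many
    events fixing that candidate. *)
Lemma measurable_reject k : measurable [set t | ~~ crs_accept M w S U t k].
Proof.
have -> : [set t | ~~ crs_accept M w S U t k] =
  \big[setU/set0]_(C : {set 'I_N})
    (S k @^-1` [set C] `&` [set t | s C <= U k t]).
  rewrite -bigcup_pred; apply/seteqP; split => t /=; rewrite /crs_accept negbK.
    by move=> H; exists (S k t).
  by move=> [C _ [/= ->]].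
apply: bigsetU_measurable => C _; apply: measurableI.
  exact: measurable_candidate.
exact: measurable_threshold.
Qed.

Lemma measurable_accept k : measurable [set t | crs_accept M w S U t k].
Proof.
have -> : [set t | crs_accept M w S U t k] =
    ~` [set t | ~~ crs_accept M w S U t k].
  by apply/seteqP; split => t /= /negP; rewrite ?negbK.
by apply: measurableC; exact: measurable_reject.
Qed.

Lemma candidate_sizeE k : [set t | #|S k t| <> M] =
  \big[setU/set0]_(C : {set 'I_N} | #|C| != M) (S k @^-1` [set C]).
Proof.
rewrite -(bigcup_pred [pred C : {set 'I_N} | #|C| != M]).
apply/seteqP; split => t /=; first by move=> /eqP H; exists (S k t).
by move=> [C /= /eqP H ->].
Qed.

Lemma measurable_candidate_size k : measurable [set t | #|S k t| <> M].
Proof.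
rewrite candidate_sizeE.
by apply: bigsetU_measurable => C _; exact: measurable_candidate.
Qed.

(** The law of [S k] fixes the size of a candidate only up to this null event, which the results on
    the output must discard. *)
Lemma prob_candidate_size k : P [set t | #|S k t| <> M] = 0.
Proof.
have [hS _ _] := rand.
rewrite candidate_sizeE; apply/eqP; rewrite eq_le measure_ge0 andbT.
rewrite -big_filter (le_trans (measure_bigsetU_le _ _ _))//.
  by move=> C; exact: measurable_candidate.
by rewrite big_filter big1//= => C CM; rewrite hS (negbTE CM).
Qed.

(** Describing the output through the first accepting round turns output events into countable
    unions of events on the draws. *)
Lemma crs_committeeP t (C : {set 'I_N}) :
  crs_committee M w S U t = Some C <->
  exists k, [/\ crs_accept M w S U t k, S k t = C
    & forall j, (j < k)%N -> ~~ crs_accept M w S U t j].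
Proof.
rewrite /crs_committee; case: pselect => [ex|nex]; last first.
  by split => // -[k [ak _ _]]; case: nex; exists k.
case: ex_minnP => m am mmin; split => [[<-]|[k [ak <- kmin]]].
  exists m; split=> // j jm; apply/negP => /mmin; rewrite leqNgt jm//.
congr (Some (S _ t)); apply/eqP; rewrite eqn_leq mmin//=.
by rewrite leqNgt; apply/negP => /kmin; rewrite am.
Qed.

Lemma measurable_output (C : {set 'I_N}) :
  measurable (output_event (crs M w S U) C).
Proof.
have -> : output_event (crs M w S U) C =
    \bigcup_k ([set t | crs_accept M w S U t k] `&` S k @^-1` [set C] `&`
      \bigcap_(j in [set j | (j < k)%N]) [set t | ~~ crs_accept M w S U t j]).
  apply/seteqP; split => t /=; rewrite /output_event/=.
    by move=> /crs_committeeP[k [ak SC kmin]]; exists k.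
  by move=> [k _ [[/= ak SC] kmin]]; apply/crs_committeeP; exists k.
apply: bigcupT_measurable => k; apply: measurableI.
  apply: measurableI; first exact: measurable_accept.
  exact: measurable_candidate.
by apply: bigcap_measurableType => j _; exact: measurable_reject.
Qed.

(** * Independence and the probability of repeated rejection *)

Lemma prob_candidates_thresholds (c : nat -> {set 'I_N}) (a : nat -> R) K :
  P (\bigcap_(k in `I_K) (S k @^-1` [set c k] `&` [set t | a k <= U k t])) =
  (\prod_(k < K) (P (S k @^-1` [set c k]) * P [set t | (a k <= U k t)%R]))%E.
Proof.
have [_ _ [_ indep]] := rand.
pose E (i : nat + nat) : set T := match i with
  | inl k => S k @^-1` [set c k] | inr k => [set t | a k <= U k t] end.
(* The [2 K] draws of the first [K] rounds, candidates before uniform variables; independence is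
   applied to this finite family. *)
pose r : seq (nat + nat) := map inl (iota 0 K) ++ map inr (iota 0 K).
have ur : uniq r.
  rewrite cat_uniq !map_inj_uniq ?iota_uniq//= ?andbT; try by move=> ? ? [].
  by apply/hasPn => x /mapP[k _ ->]; apply/mapP => -[].
pose J := seq_fset tt r.
have JE : J =i r by move=> i; rewrite seq_fsetE.
have := indep J E _.
rewrite (_ : \bigcap_(i in [set` J]) E i = \bigcap_(k in `I_K)
    (S k @^-1` [set c k] `&` [set t | a k <= U k t])); last first.
  apply/seteqP; split => t /= H.
    move=> k /= kK; split; [apply: (H (inl k))|apply: (H (inr k))].
      by rewrite /= JE mem_cat map_f ?mem_iota.
    by rewrite /= JE mem_cat [X in _ || X]map_f ?mem_iota ?orbT.
  move=> i /=; rewrite JE mem_cat => /orP[] /mapP[k];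
    rewrite mem_iota add0n => /= kK ->; by case: (H k kK).
move=> ->.
  have pJ : perm_eq J r.
    by apply: uniq_perm => //; exact: fset_uniq.
  rewrite (perm_big _ pJ)/= big_cat/= !big_map big_split/=.
  rewrite -(big_mkord xpredT (fun k => P (S k @^-1` [set c k]))).
  rewrite -(big_mkord xpredT (fun k => P [set t | (a k <= U k t)%R])).
  by rewrite /index_iota subn0.
move=> [] k _ /=; first by exists [set c k].
by exists [set x | a k <= x]; first exact: measurable_ge.
Qed.

(** The acceptance probability of one round: the mean threshold of a uniform [M]-subset, once
    thresholds lie in [[0, 1]]. *)
Let q : R := 'C(N, M)%:R^-1 * \sum_(C : {set 'I_N} | #|C| == M) s C.

Hypotheses (M0 : (0 < M)%N) (MN : (M <= N)%N).
Hypothesis p_bounds : forall i, 0 <= crs_p M w i <= M%:R^-1.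

Lemma prob_threshold k (a : R) : 0 <= a <= 1 ->
  P [set t | a <= U k t] = (1 - a)%:E.
Proof.
move=> a01; have [_ hU _] := rand.
rewrite -uniform_prob_ge// -(hU k)//.
exact: measurable_ge.
Qed.

(* A round rejects with probability [1 - q], but independence is only assumed
   for the individual draws: the rejection event is split along the candidates
   of all the rounds, and the product of sums is recovered from the sum of
   products. *)
Lemma prob_reject_rounds K :
  (P (\bigcap_(k in `I_K) [set t | ~~ crs_accept M w S U t k])
    <= ((1 - q) ^+ K)%:E)%E.
Proof.
have [hS _ _] := rand.
(* [a C] is the probability that a round draws [C] and rejects it. *)
pose a (C : {set 'I_N}) : R :=
  if #|C| == M then 'C(N, M)%:R^-1 * (1 - s C) else 0.
have aE k C : (P (S k @^-1` [set C]) * P [set t | (s C <= U k t)%R] = (a C)%:E)%E.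
  rewrite hS /a; case: eqP => [CM|_]; last by rewrite mul0e.
  by rewrite prob_threshold ?crs_p_committee.
have suma : \sum_C a C = 1 - q.
  rewrite /a -big_mkcond/= -mulr_sumr sumrB mulrBr; congr (_ - _).
  rewrite sumr_const.
  have -> : #|[pred C : {set 'I_N} | #|C| == M]| = 'C(N, M).
    rewrite -[in RHS](card_ord N) -card_draws.
    by apply: eq_card => C; rewrite !inE.
  by rewrite mulVf// pnatr_eq0 -lt0n bin_gt0.
(* A choice of candidates for [K] rounds is extended to all of [nat] by the empty set; only indices
   below [K] enter [E c]. *)
pose ext (c : {ffun 'I_K -> {set 'I_N}}) k :=
  if insub k is Some i then c i else finset.set0.
pose E c := \bigcap_(k in `I_K) (S k @^-1` [set ext c k] `&`
  [set t | s (ext c k) <= U k t]).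
have mE c : measurable (E c).
  apply: bigcap_measurableType => k _; apply: measurableI.
    exact: measurable_candidate.
  exact: measurable_threshold.
(* The events [E c] cover the rejection event, the index [c] being the sequence of candidates
   actually drawn; the union bound then suffices. *)
apply: (@le_trans _ _ (P (\big[setU/set0]_c E c))).
  apply: le_measure; rewrite ?inE.
  - by apply: bigcap_measurableType => j _; exact: measurable_reject.
  - exact: bigsetU_measurable.
  - move=> t H; rewrite -(bigcup_pred predT).
    exists [ffun i : 'I_K => S i t] => //= k /= kK.
    rewrite /ext insubT/= ffunE; split=> //.
    by have /= := H k kK; rewrite /crs_accept negbK.
rewrite (le_trans (measure_bigsetU_le _ _ mE))//.
rewrite -suma -[X in _ ^+ X](card_ord K) -prodr_const bigA_distr_bigA/=.
rewrite -sumEFin le_eqVlt; apply/orP; left; apply/eqP/eq_bigr => c _.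
rewrite /E prob_candidates_thresholds -prodEFin; apply: eq_bigr => i _.
by rewrite aE /ext valK.
Qed.

(** * Almost sure termination *)

Hypothesis p_sum : \sum_(i < N) crs_p M w i = 1.

(** Nonnegative numbers of sum 1 cannot all vanish, and an [M]-subset containing an [i] with
    [crs_p M w i > 0] has a positive threshold. *)
Lemma acceptance_gt0 : 0 < q.
Proof.
have sC (C : {set 'I_N}) : #|C| = M -> 0 <= s C.
  by move=> CM; case/andP: (crs_p_committee M0 p_bounds CM).
apply: mulr_gt0; first by rewrite invr_gt0 ltr0n bin_gt0.
have [i pi] : exists i, 0 < crs_p M w i.
  apply: contrapT => /forallNP np.
  have : \sum_(i < N) crs_p M w i = 0.
    apply: big1 => i _; apply/eqP; rewrite eq_le.
    by case/andP: (p_bounds i) => -> _; rewrite leNgt andbT; apply/negP/np.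
  by rewrite p_sum => /eqP; rewrite oner_eq0.
have [|C CM iC] := @ex_subset_card _ i M; first by rewrite M0 card_ord.
rewrite (bigD1 C) ?CM//= ltr_pwDl//.
  rewrite /s (bigD1 i)//= ltr_pwDl// sumr_ge0// => j _.
  by case/andP: (p_bounds j).
by apply: sumr_ge0 => D /andP[/eqP /sC].
Qed.

Lemma prob_never_accept :
  P (\bigcap_k [set t | ~~ crs_accept M w S U t k]) = 0.
Proof.
have mr K : measurable (\bigcap_(k in `I_K) [set t | ~~ crs_accept M w S U t k]).
  by apply: bigcap_measurableType => j _; exact: measurable_reject.
have mN : measurable (\bigcap_k [set t | ~~ crs_accept M w S U t k]).
  by apply: bigcap_measurableType => j _; exact: measurable_reject.
have q0 := acceptance_gt0.
(* The bound for a single round dominates a probability, so [1 - q] is nonnegative; with [0 < q] its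
   powers tend to 0. *)
have q1 : 0 <= 1 - q.
  have := prob_reject_rounds 1; rewrite expr1 -lee_fin; apply: le_trans.
  exact: measure_ge0.
have cv : (fun K => ((1 - q) ^+ K)%:E) @ \oo --> 0%:E.
  apply: cvg_EFin; first exact: nearW.
  by apply: cvg_expr; rewrite ger0_norm//; lra.
apply/eqP; rewrite eq_le measure_ge0 andbT.
apply: (cvge_to_ge cv).
near=> K.
apply: le_trans (prob_reject_rounds K); apply: le_measure; rewrite ?inE//.
by move=> t H k _; exact: H.
Unshelve. all: by end_near. Qed.

(** * Size of the output and decentralization *)

Lemma crs_sortition_algorithm :
  sortition_algorithm P M (crs M w S U).
Proof.
split; first exact: measurable_output.
set G := [set t | _].
have mG : measurable G.
  have -> : G = \big[setU/set0]_(C : {set 'I_N} | #|C| == M)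
      output_event (crs M w S U) C.
    rewrite -(bigcup_pred [pred C : {set 'I_N} | #|C| == M]).
    apply/seteqP; split => t /=; first by move=> [C tC /eqP CM]; exists C.
    by move=> [C /= /eqP CM tC]; exists C.
  by apply: bigsetU_measurable => C _; exact: measurable_output.
have mB : measurable (\bigcup_k [set t | #|S k t| <> M]).
  by apply: bigcupT_measurable => k; exact: measurable_candidate_size.
(* Failure means that no round accepts or that some candidate has the wrong size: a countable union
   of null events. *)
have GC : P (~` G) = 0.
  apply: measure_negligible; first exact: measurableC.
  apply: (@negligibleS _ _ _ _ (\bigcap_k [set t | ~~ crs_accept M w S U t k]
      `|` \bigcup_k [set t | #|S k t| <> M])).
    move=> t /= nG; case tC: (crs_committee M w S U t) => [C|].
      have /crs_committeeP[k [_ SC _]] := tC.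
      by right; exists k => //= SM; apply: nG; exists C; rewrite // -SC.
    left=> k _ /=; move: tC; rewrite /crs_committee.
    by case: pselect => // nex _; apply/negP => ak; apply: nex; exists k.
  apply: negligibleU.
    exists (\bigcap_k [set t | ~~ crs_accept M w S U t k]); split => //.
      by apply: bigcap_measurableType => j _; exact: measurable_reject.
    exact: prob_never_accept.
  apply: negligible_bigcup => k; exists [set t | #|S k t| <> M]; split => //.
    exact: measurable_candidate_size.
  exact: prob_candidate_size.
have := probability_setC P (measurableC mG).
by rewrite setCK GC sube0.
Qed.

Lemma output_size (C : {set 'I_N}) :
  (0 < P (output_event (crs M w S U) C))%E -> #|C| = M.
Proof.
apply: contraPP => CM; apply/negP; rewrite -leNgt le_eqVlt; apply/orP; left.
apply/eqP; apply: measure_negligible; first exact: measurable_output.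
apply: (@negligibleS _ _ _ _ (\bigcup_k [set t | #|S k t| <> M])).
  move=> t /crs_committeeP[k [_ SC _]].
  by exists k => //=; rewrite SC.
apply: negligible_bigcup => k; exists [set t | #|S k t| <> M]; split => //.
  exact: measurable_candidate_size.
exact: prob_candidate_size.
Qed.

End CrsLaw.

(* The default 1 of the minimum is harmless: every w i is at most 1. *)
Theorem proposition4p4 (R : realType) (d : measure_display)
    (T : measurableType d) (P : probability T R) (N M : nat) (w : 'I_N -> R)
    (S : nat -> T -> {set 'I_N}) (U : nat -> {RV P >-> R})
    (hM : (2 < M)%N) (hMN : (M < N)%N)
    (w_gt0 : forall i, 0 < w i) (w_sum : \sum_(i < N) w i = 1)
    (w_bounds : forall i,
      (M%:R - 1) / (M%:R * (N%:R - 1)) <= w i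
        <= (N%:R - 2 * M%:R + M%:R ^+ 2) / (M%:R ^+ 2 * (N%:R - 1)))
    (rand : crs_randomness M S U) :
  sortition_algorithm P M (crs M w S U) /\
  decentralized P w (crs M w S U) (M%:R * \big[Num.min/1]_(i < N) w i).
Proof.
have M0 : (0 < M)%N by apply: leq_trans hM.
have p_bounds i : 0 <= crs_p M w i <= M%:R^-1 by exact: crs_p_bounds.
have p_sum := crs_p_sum hMN w_sum.
split; first exact: (crs_sortition_algorithm rand M0 (ltnW hMN)).
have w0 : 0 < \big[Num.min/1]_(i < N) w i by exact: lt_bigmin.
split; first by rewrite mulr_gt0// ltr0n.
move=> C /(output_size rand) CM.
(* The starting value 0 of the maximum is handled by the sign of the bound; for a member [m] the
   ratio is [M^-1 / w m], and the minimum is at most [w m]. *)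
apply: bigmax_le => [|m mC]; first by rewrite invr_ge0 mulr_ge0// ltW.
rewrite crs_voting_power// CM invfM ler_wpM2l ?invr_ge0//.
by rewrite lef_pV2 ?posrE// bigmin_le.
Qed.
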